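(* Let $k\ge1$ be an integer and let $PT^*_k(z)=\sum_{i\ge0} p_i z^i$, where $p_i$ is the number of prefix grand $k$-Fibonacci paths of length $i$. Then \[ PT^*_k(z)=\frac{1-kz-z^2}{1-(k+3)z-(1-2k)z^2+2z^3}. \]
   Context: For a positive integer $k$, the $k$-Fibonacci numbers are defined by $F_{k,0}=0$, $F_{k,1}=1$, $F_{k,n+1}=kF_{k,n}+F_{k,n-1}$ for $n\ge1$. A prefix grand $k$-Fibonacci path of length $n$ is a lattice path in $\mathbb{Z}\times\mathbb{Z}$ starting at $(0,0)$ and ending at some point $(n,j)$ with $j\in\mathbb{Z}$ arbitrary (no restriction on going below the $x$-axis), built from rise steps $U=(1,1)$, fall steps $D=(1,-1)$, and horizontal steps $H_l=(l,0)$ for any positive integer $l$, where each step $H_l$ is additionally assigned one of $F_{k,l}$ colors (differently colored paths are counted as different). The empty path is the unique one of length $0$. *)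

(* Defs.v *)
From HB Require Import structures.
From mathcomp Require Import all_boot all_order all_algebra.
From mathcomp Require Import finmap.
From mathcomp Require Import boolp classical_sets functions cardinality.

Set Implicit Arguments.
Unset Strict Implicit.
Unset Printing Implicit Defensive.

Import Order.TTheory GRing.Theory Num.Theory.

Local Open Scope ring_scope.

Fixpoint kfib (k n : nat) : nat :=
  match n with
  | 0 => 0
  | 1 => 1
  | (m.+1 as n').+1 => k * kfib k n' + kfib k m
  end%N.

(* [Horiz l c] is the step H_l of length l = sval l >= 1, with colour c. *)
Inductive kstep (k : nat) : Type :=
| Rise
| Fall
| Horiz (l : {l : nat | (0 < l)%N}) (c : 'I_(kfib k (sval l))).

Arguments Rise {k}.
Arguments Fall {k}.
Arguments Horiz {k} l c.

Section StepChoice.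
Variable k : nat.

Let code : Type := (bool + {l : {l : nat | (0 < l)%N} & 'I_(kfib k (sval l))})%type.

Definition kstep_code (s : kstep k) : code :=
  match s with
  | Rise => inl true
  | Fall => inl false
  | Horiz l c => inr (existT _ l c)
  end.

Definition kstep_decode (x : code) : kstep k :=
  match x with
  | inl true => Rise
  | inl false => Fall
  | inr (existT l c) => Horiz l c
  end.

Lemma kstep_codeK : cancel kstep_code kstep_decode.
Proof. by case. Qed.

HB.instance Definition _ := Countable.copy (kstep k) (can_type kstep_codeK).

End StepChoice.

Definition step_vec (k : nat) (s : kstep k) : int * int :=
  match s with
  | Rise => (1, 1)
  | Fall => (1, -1)
  | Horiz l _ => ((sval l)%:Z, 0)
  end.

(* A path starts at (0,0), so it is given by the sequence of its steps. *)
Definition endpoint (k : nat) (w : seq (kstep k)) : int * int :=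
  \sum_(s <- w) step_vec s.

Definition prefix_grand_paths (k n : nat) : set (seq (kstep k)) :=
  [set w | exists j : int, endpoint w = (n%:Z, j)]%classic.

Arguments prefix_grand_paths : clear implicits.

(* [fset_set] is a junk value on infinite sets; see [finite_prefix_grand_paths]. *)
Definition nb_prefix_grand_paths (k n : nat) : nat :=
  #|` fset_set (prefix_grand_paths k n)|.

Lemma step_vec1_ge1 (k : nat) (s : kstep k) : 1 <= (step_vec s).1.
Proof. by case: s => //= -[]. Qed.

Lemma finite_short_steps (k n : nat) :
  finite_set [set s : kstep k | (step_vec s).1 <= n%:Z]%classic.
Proof.
pose hs : seq (kstep k) := flatten [seq
  (if insub l is Some l' then [seq Horiz l' c | c <- enum 'I_(kfib k (sval l'))]
   else [::]) | l <- iota 0 n.+1].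
apply: (sub_finite_set _ (finite_seq [:: Rise, Fall & hs])) => s /=.
case: s => [_|_|l c /=]; rewrite ?inE ?eqxx ?orbT // lez_nat => ln.
apply/orP; right; apply/orP; right; apply/flattenP.
exists [seq Horiz l c | c <- enum 'I_(kfib k (sval l))].
  apply/mapP; exists (val l); first by rewrite mem_iota.
  by rewrite valK.
by apply: map_f; rewrite mem_enum.
Qed.

Lemma finite_prefix_grand_paths (k n : nat) :
  finite_set (prefix_grand_paths k n).
Proof.
pose S : set (kstep k) := [set s | (step_vec s).1 <= n%:Z]%classic.
pose W m : set (seq (kstep k)) :=
  [set w | (size w <= m)%N /\ forall s, s \in w -> S s]%classic.
have finW m : finite_set (W m).
  elim: m => [|m IHm].
    by apply: (sub_finite_set _ (finite_set1 [::])) => -[|s w] [].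
  have := finite_setU [set [::] : seq (kstep k)]
    [set (s :: w) | s in S & w in W m].
  move=> finU; apply: (@sub_finite_set _ _
    ([set [::]] `|` [set (s :: w) | s in S & w in W m])%classic); last first.
    rewrite finU; split; first exact: finite_set1.
    by apply: finite_image2 => //; exact: finite_short_steps.
  case=> [|s w] [sw Sw]; [by left|right].
  exists s; first by apply: Sw; rewrite inE eqxx.
  by exists w => //; split=> // t tw; apply: Sw; rewrite inE tw orbT.
have leW (w : seq (kstep k)) : (size w)%:Z <= (endpoint w).1 /\
    forall s, s \in w -> (step_vec s).1 <= (endpoint w).1.
  elim: w => [|s w [szw lew]]; first by rewrite /endpoint big_nil.
  rewrite /endpoint big_cons -/(endpoint w) /=.
  have s1 := step_vec1_ge1 s.
  have w0 : 0 <= (endpoint w).1 by apply: le_trans szw.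
  split; first by rewrite -add1n PoszD lerD.
  move=> t; rewrite inE => /predU1P[->|/lew tw]; first by rewrite lerDl.
  by rewrite (le_trans tw)// lerDr (le_trans _ s1).
apply: (sub_finite_set _ (finW n)) => w [j wE].
by have [] := leW w; rewrite wE lez_nat.
Qed.

Definition fps (R : Type) : Type := nat -> R.

Definition fps_of_poly (R : nzRingType) (p : {poly R}) : fps R :=
  fun n => p`_n.

Definition fps_mul (R : nzRingType) (f g : fps R) : fps R :=
  fun n => \sum_(i < n.+1) f i * g (n - i)%N.

(* [fps_inv_coefs f n] lists the coefficients n-1, ..., 0 (in this order) of
   the inverse g of f, using g_0 = f_0^-1 and
   g_n = - f_0^-1 (f_1 g_(n-1) + ... + f_n g_0) for n > 0. *)
Fixpoint fps_inv_coefs (R : comUnitRingType) (f : fps R) (n : nat) : seq R :=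
  if n is m.+1 then
    let s := fps_inv_coefs f m in
    (if m == 0%N then (f 0%N)^-1
     else - (f 0%N)^-1 * \sum_(i < m) f i.+1 * s`_i) :: s
  else [::].

(* Meaningful when f 0 is a unit, see [fps_mulV]. *)
Definition fps_inv (R : comUnitRingType) (f : fps R) : fps R :=
  fun n => (fps_inv_coefs f n.+1)`_0.

Definition fps_div (R : comUnitRingType) (f g : fps R) : fps R :=
  fps_mul f (fps_inv g).

Lemma nth_fps_inv_coefs (R : comUnitRingType) (f : fps R) (n i : nat) :
  (i < n)%N -> (fps_inv_coefs f n)`_i = fps_inv f (n - i.+1)%N.
Proof.
elim: n i => [//|n IHn] [_|i]; first by rewrite subn1.
by rewrite ltnS => lt_in; rewrite [LHS]IHn// subSS.
Qed.

Lemma fps_mulV (R : comUnitRingType) (f : fps R) :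
  f 0%N \is a GRing.unit -> fps_mul f (fps_inv f) = fps_of_poly 1.
Proof.
move=> f0; apply/funext => -[|n]; rewrite /fps_mul /fps_of_poly coef1.
  by rewrite big_ord1 /fps_inv /= divrr.
rewrite big_ord_recl subn0 {1}/fps_inv [fps_inv_coefs _ _]/=.
rewrite -[_`_0]/(- (f 0%N)^-1 * \sum_(i < n.+1) f i.+1 * (fps_inv_coefs f n.+1)`_i).
rewrite mulNr mulrN mulrA divrr// mul1r addrC; apply/eqP; rewrite subr_eq0.
by apply/eqP/eq_bigr => i _; rewrite nth_fps_inv_coefs.
Qed.

Definition PT (k : nat) : fps int :=
  fun i => (nb_prefix_grand_paths k i)%:Z.

(* Main.v *)
Require Import Defs.
From mathcomp Require Import all_boot all_order all_algebra.
From mathcomp Require Import finmap boolp classical_sets functions cardinality.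
From mathcomp Require Import zify.
Import GRing.Theory.
Local Open Scope ring_scope.

(** Splitting off the first step gives, with [c n := sum_(i <= n) F_(i+1) p_(n-i)]
    counting the paths of length n+1 that start with a horizontal step,
      p_(n+1) = 2 p_n + c_n,
    and the Fibonacci recurrence gives c_(n+2) = p_(n+2) + k c_(n+1) + c_n.
    Eliminating c yields p_(n+3) = (k+3) p_(n+2) + (1-2k) p_(n+1) - 2 p_n, so that
    PT times the denominator is the numerator. *)

(** The coefficient of index [n] of a product sees only indices up to [n], so truncating to
    polynomials is harmless; ring laws of [{poly R}] thereby pass to series. *)
Lemma fps_mul_coef (R : nzRingType) (f g : fps R) (m n : nat) : (n < m)%N ->
  fps_mul f g n = ((\poly_(i < m) f i) * (\poly_(i < m) g i))`_n.
Proof.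
move=> nm; rewrite coefM; apply: eq_bigr => i _; rewrite !coef_poly.
by rewrite (leq_ltn_trans (leq_ord i) nm) (leq_ltn_trans (leq_subr i n) nm).
Qed.

Lemma fps_mulC (R : comNzRingType) (f g : fps R) : fps_mul f g = fps_mul g f.
Proof.
by apply/funext => n; rewrite !(fps_mul_coef _ _ _ n.+1 n)// mulrC.
Qed.

Lemma fps_mulA (R : nzRingType) (f g h : fps R) :
  fps_mul f (fps_mul g h) = fps_mul (fps_mul f g) h.
Proof.
apply/funext => n.
pose T (u : fps R) := \poly_(i < n.+1) u i.
have TE (u : fps R) i : (i <= n)%N -> (T u)`_i = u i.
  by move=> le_in; rewrite coef_poly ltnS le_in.
transitivity ((T f * (T g * T h))`_n); last rewrite mulrA.
  rewrite coefM; apply: eq_bigr => i _.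
  by rewrite TE ?leq_ord// (fps_mul_coef _ _ _ n.+1)// ltnS leq_subr.
rewrite coefM; apply: eq_bigr => i _.
by rewrite TE ?leq_subr// (fps_mul_coef _ _ _ n.+1).
Qed.

Lemma fps_mulr1 (R : nzRingType) (f : fps R) : fps_mul f (fps_of_poly 1) = f.
Proof.
apply/funext => n; rewrite /fps_mul big_ord_recr /= subnn.
rewrite big1 ?add0r => [|i _]; first by rewrite /fps_of_poly coef1 mulr1.
by rewrite /fps_of_poly coef1 subn_eq0 leqNgt ltn_ord mulr0.
Qed.

Lemma fps_divP (R : comUnitRingType) (f g h : fps R) :
  g 0%N \is a GRing.unit -> fps_mul g h = f -> h = fps_div f g.
Proof.
by move=> g0 <-; rewrite /fps_div (fps_mulC _ g h) -fps_mulA fps_mulV ?fps_mulr1.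
Qed.

Section Paths.
Variable k : nat.

Definition step_len (s : kstep k) : nat :=
  if s is Horiz l _ then sval l else 1.

Definition path_len (w : seq (kstep k)) : nat := \sum_(s <- w) step_len s.

Lemma step_len_gt0 (s : kstep k) : (0 < step_len s)%N.
Proof. by case: s => //= -[]. Qed.

Lemma endpoint_fst (w : seq (kstep k)) : (endpoint w).1 = (path_len w)%:Z.
Proof.
elim: w => [|s w IHw]; first by rewrite /endpoint /path_len !big_nil.
rewrite /endpoint /path_len !big_cons /= -/(endpoint w) IHw PoszD.
by case: s.
Qed.

Lemma mem_prefix_grand_paths (n : nat) (w : seq (kstep k)) :
  prefix_grand_paths k n w <-> path_len w = n.
Proof.
split=> [[j]|<-]; first by move/(congr1 fst); rewrite endpoint_fst => -[].
by exists (endpoint w).2; rewrite -endpoint_fst; case: (endpoint w).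
Qed.

Definition short_horizs (n : nat) : seq (kstep k) :=
  [seq Horiz (exist _ i.+1 (ltn0Sn i)) c |
     i <- iota 0 n, c <- enum 'I_(kfib k i.+1)].

Definition short_steps (n : nat) : seq (kstep k) :=
  [:: Rise, Fall & short_horizs n].

Lemma mem_short_steps (n : nat) (s : kstep k) :
  (s \in short_steps n.+1) = (step_len s <= n.+1)%N.
Proof.
rewrite !inE; case: s => [||[[//|l] l0] c]; rewrite ?eqxx ?orbT //=.
apply/allpairsPdep/idP => [[i [d [+ _ /(congr1 step_len) [->]]]]|ln].
  by rewrite mem_iota.
exists l, c; rewrite mem_iota mem_enum; split=> //.
(* The type of the colour [c] mentions the positivity proof [l0], so the two proofs must be
   identified before the steps can be compared. *)
have p : ltn0Sn l = l0 by exact: bool_irrelevance.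
by case: _ / p c.
Qed.

Lemma uniq_short_steps (n : nat) : uniq (short_steps n).
Proof.
rewrite /= inE negb_or /=; apply/and3P; split; try by apply/allpairsPdep => -[? [? []]].
apply: allpairs_uniq_dep => [|i _|[i c] [j d] _ _ /= eq_h]; rewrite ?iota_uniq ?enum_uniq//.
have eq_ij : i = j by case: eq_h.
(* Coding the steps as tagged pairs over a type with decidable equality makes equal steps of equal
   length have equal colours. *)
case: _ / eq_ij d eq_h => d /(congr1 (@kstep_code k)) /= [] /eqP.
by rewrite eq_Tagged /= => /eqP ->.
Qed.

(* Lists the paths of length n as soon as n <= m. *)
Fixpoint path_enum (m n : nat) : seq (seq (kstep k)) :=
  match n, m with
  | 0, _ => [:: [::]]
  | _, 0 => [::]
  | _, m'.+1 =>
    [seq s :: w | s <- short_steps n, w <- path_enum m' (n - step_len s)]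
  end.

(** Every step has length at least 1, so the length left to fill drops at least as fast as the fuel
    [m], and the bound is preserved. *)
Lemma mem_path_enum (m n : nat) (w : seq (kstep k)) : (n <= m)%N ->
  (w \in path_enum m n) = (path_len w == n).
Proof.
elim: m n w => [|m IHm] [|n] w //; rewrite ?ltnS => nm.
- case: w => [|s w]; rewrite /path_len ?big_nil// big_cons /= inE.
  by rewrite addn_eq0 eqn0Ngt step_len_gt0.
- case: w => [|s w]; rewrite /path_len ?big_nil// big_cons /= inE.
  by rewrite addn_eq0 eqn0Ngt step_len_gt0.
apply/allpairsPdep/eqP => [[s [v [+ + ->]]]|].
  rewrite mem_short_steps => sn; have s0 := step_len_gt0 s.
  rewrite IHm; last lia.
  by rewrite /path_len big_cons => /eqP ->; lia.
case: w => [|s w]; rewrite /path_len ?big_nil// big_cons => wn.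
have s0 := step_len_gt0 s.
exists s, w; rewrite mem_short_steps IHm ?/path_len; last lia.
by split=> //; [lia | apply/eqP; lia].
Qed.

Lemma uniq_path_enum (m n : nat) : uniq (path_enum m n).
Proof.
elim: m n => [|m IHm] [|n] //.
apply: allpairs_uniq_dep => [|s _|[s v] [t w] _ _ /= [-> ->]] //.
exact: uniq_short_steps.
Qed.

Lemma nb_prefix_grand_pathsE (m n : nat) : (n <= m)%N ->
  nb_prefix_grand_paths k n = size (path_enum m n).
Proof.
move=> nm; rewrite /nb_prefix_grand_paths.
have -> : prefix_grand_paths k n = [set` path_enum m n]%classic.
  apply/seteqP; split=> w; rewrite /= mem_path_enum//.
    by move/mem_prefix_grand_paths/eqP.
  by move/eqP/mem_prefix_grand_paths.
have -> : [set` path_enum m n]%classic = [set` [fset x in path_enum m n]%fset]%classic.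
  by apply/seteqP; split=> w /=; rewrite inE.
by rewrite set_fsetK card_fseq undup_id// uniq_path_enum.
Qed.

Lemma nb_prefix_grand_paths0 : nb_prefix_grand_paths k 0 = 1%N.
Proof. by rewrite (nb_prefix_grand_pathsE 0). Qed.

Definition nb_horiz_first (n : nat) : nat :=
  \sum_(i < n.+1) kfib k i.+1 * nb_prefix_grand_paths k (n - i).

Lemma nb_prefix_grand_pathsS (n : nat) :
  nb_prefix_grand_paths k n.+1 = (2 * nb_prefix_grand_paths k n + nb_horiz_first n)%N.
Proof.
(* With fuel [n.+1], one unfolding leaves tails of length at most [n] with fuel [n], so they are
   again counted by [nb_prefix_grand_paths]. *)
rewrite (nb_prefix_grand_pathsE n.+1)// [path_enum _ _]/path_enum -/path_enum.
rewrite size_allpairs_dep sumnE big_map !big_cons /= subSS subn0.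
rewrite -nb_prefix_grand_pathsE// addnA mul2n addnn; congr (_ + _)%N.
rewrite big_allpairs_dep /= -/(iota 0 n.+1) -{1}[n.+1]subn0 -/(index_iota 0 n.+1).
rewrite big_mkord; apply: eq_bigr => i _.
rewrite subSS -nb_prefix_grand_pathsE ?leq_subr//.
by rewrite big_const_seq count_predT size_enum_ord iter_addn_0 mulnC.
Qed.

Lemma nb_horiz_first0 : nb_horiz_first 0 = 1%N.
Proof. by rewrite /nb_horiz_first big_ord1 nb_prefix_grand_paths0. Qed.

Lemma nb_horiz_first1 : nb_horiz_first 1 = (nb_prefix_grand_paths k 1 + k)%N.
Proof.
rewrite /nb_horiz_first !big_ord_recl big_ord0 /= nb_prefix_grand_paths0.
by rewrite mul1n !addn0 !muln1 subn0.
Qed.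

Lemma nb_horiz_firstSS (n : nat) :
  nb_horiz_first n.+2 =
  (nb_prefix_grand_paths k n.+2 + k * nb_horiz_first n.+1 + nb_horiz_first n)%N.
Proof.
rewrite {1}/nb_horiz_first big_ord_recl /= mul1n subn0 -addnA; congr (_ + _)%N.
under eq_bigr => i _ do rewrite subSS mulnDl -mulnA.
rewrite big_split /= -big_distrr /=; congr (_ + _)%N.
(* The term of index 0 vanishes since [kfib k 0] is 0; shifting the index in the rest gives
   [nb_horiz_first n]. *)
by rewrite big_ord_recl.
Qed.

End Paths.

(** From index 3 on, multiplying by a cubic is a four-term linear recurrence; the lower indices are
    left as initial conditions. *)
Lemma fps_mul_poly4 (R : nzRingType) (p : {poly R}) (f : fps R) (n : nat) :
  (size p <= 4)%N ->
  fps_mul (fps_of_poly p) f n.+3 =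
  p`_0 * f n.+3 + p`_1 * f n.+2 + p`_2 * f n.+1 + p`_3 * f n.
Proof.
move=> sp; rewrite /fps_mul /fps_of_poly !big_ord_recl /= /bump /=.
rewrite big1 ?addr0 => [|i _]; last by rewrite nth_default ?mul0r// (leq_trans sp).
by rewrite !addrA !subSS !subn0.
Qed.

Theorem theorem3p12 (k : nat) (hk : (1 <= k)%N) :
  PT k =
  fps_div
    (fps_of_poly (1 - k%:Z *: 'X - 'X^2))
    (fps_of_poly (1 - (k%:Z + 3) *: 'X - (1 - 2 * k%:Z) *: 'X^2 + 2 *: 'X^3)).
Proof.
set N := 1 - _ - _; set D := _ + _.
have DE i : D`_i = (i == 0)%:R - (k%:Z + 3) * (i == 1)%:R
    - (1 - 2 * k%:Z) * (i == 2)%:R + 2 * (i == 3)%:R.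
  by rewrite /D !(coefD, coefN, coefZ, coefXn, coefX, coef1).
have NE i : N`_i = (i == 0)%:R - k%:Z * (i == 1)%:R - (i == 2)%:R.
  by rewrite /N !(coefD, coefN, coefZ, coefXn, coefX, coef1).
have size_D : (size D <= 4)%N.
  by apply/leq_sizeP => -[|[|[|[|i]]]] // _; rewrite DE /= !mulr0 oppr0 !addr0.
have p0 := nb_prefix_grand_paths0 k; have pS := nb_prefix_grand_pathsS k.
have c0 := nb_horiz_first0 k; have c1 := nb_horiz_first1 k.
(* The denominator has constant term 1, hence it suffices that its product with [PT k] is [N]. *)
apply: fps_divP; first by rewrite /fps_of_poly DE /= !mulr0 oppr0 !addr0 unitr1.
apply: funext => -[|[|[|n]]]; last first.
- rewrite fps_mul_poly4// /fps_of_poly NE !DE /PT /=.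
  have := nb_horiz_firstSS k n.
  have := pS n.+2; have := pS n.+1; have := pS n.
  (* Here [N] contributes 0. Eliminating [x] and [y] multiplies the equation for [y] by [k], which
     makes the goal nonlinear. *)
  move: (nb_horiz_first k n) (nb_horiz_first k n.+1) => x y.
  nia.
(* Index 2: with initial counts 1, 3 and [k + 9], the coefficient is
   [(k + 9) - 3 * (k + 3) - (1 - 2 * k) = -1]. *)
- rewrite /fps_mul /fps_of_poly !big_ord_recl big_ord0 /= !DE NE /PT /=.
  rewrite /bump /= !(subn0, subnn) p0 !pS c1 pS c0 p0; lia.
- rewrite /fps_mul /fps_of_poly !big_ord_recl big_ord0 /= !DE NE /PT /=.
  rewrite /bump /= !(subn0, subnn) p0 pS c0 p0; lia.
- rewrite /fps_mul /fps_of_poly big_ord1 DE NE /PT subnn p0 /=; lia.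
Qed.
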